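(* Let $r,s,t\ge 0$ be integers. For each $1\le i\le r$ let $p_i$ be a prime with $p_i = a_i^2+b_i^2 \equiv 1 \pmod 8$ for some integers $a_i,b_i$ such that both $a_i+b_i$ and $a_i-b_i$ lie in $\{8m\pm 1 \mid m\in\mathbb{Z}\}$; let $p_{r+1},\dots,p_{r+s}$ be primes congruent to $7$ modulo $8$; let $q_1,\dots,q_t$ be distinct primes congruent to $3$ modulo $8$; and let $k_1,\dots,k_{r+s}$ be non-negative integers. Then $$64\, p_1^{k_1}\cdots p_r^{k_r}\, p_{r+1}^{k_{r+1}}\cdots p_{r+s}^{k_{r+s}} \notin S(16) \quad\text{and}\quad 64\, p_1^{k_1}\cdots p_r^{k_r}\, p_{r+1}^{k_{r+1}}\cdots p_{r+s}^{k_{r+s}}\, q_1\cdots q_t \notin S(16).$$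
   Context: $S(16)$ is the set of all values $D(a_0,\dots,a_{15})$ with $a_i\in\mathbb{Z}$, where $D(a_0,\dots,a_{15})$ is the determinant of the $16\times16$ circulant matrix whose $(i,j)$ entry ($0\le i,j\le15$) is $a_{(i-j)\bmod 16}$. *)

(* Defs.v *)
From HB Require Import structures.
From mathcomp Require Import all_boot all_order all_algebra.

Set Implicit Arguments.
Unset Strict Implicit.
Unset Printing Implicit Defensive.

Import Order.TTheory GRing.Theory Num.Theory.
Local Open Scope ring_scope.

(* The subtraction [i - j] is that of the additive group ['I_16], hence it is
   taken modulo 16. *)
Definition circulant16 (a : 'I_16 -> int) : 'M[int]_16 :=
  \matrix_(i < 16, j < 16) a (i - j).

Definition D16 (a : 'I_16 -> int) : int := \det (circulant16 a).

Definition S16 (d : int) : Prop := exists a : 'I_16 -> int, d = D16 a.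

Definition pm1_mod8 (x : int) : Prop :=
  exists m : int, x = 8 * m + 1 \/ x = 8 * m - 1.

(* Main.v *)
(* Let f be the polynomial with coefficients a_i, z a primitive 16th root of
   unity and i = z^4. The determinant is f(1) f(-1) |A|^2 |B|^2 |C|^2, where
   A = f(i), and B, C are the norms of f(z^2), f(z) to Z[i]. If it equals 64 n
   with n odd, then f(1) f(-1) is 8 modulo 16, and the three norms |A|^2, |B|^2,
   |C|^2 are twice divisors of n.
   For the given n, a prime q congruent to 3 modulo 8 cannot divide a norm from
   Z[i], since it would then occur squared; removing the other primes from a
   sum of two squares 2 m one at a time (in Z[i]) shows that the real and
   imaginary parts of A, B and C are all 1 or -1 modulo 8.
   These congruences are incompatible. Put P(x) = x_0 x_2 - x_1 x_3 and let d, e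
   be the coefficients of f modulo x^4 - 1, x^4 + 1, and g those of the norm
   of f(z) to Z[z^2]. Modulo 4, the condition on f(1), f(-1) and A gives
   P(d) = 2, those on B and C give P(e) = P(g) = 0, whereas
   P(d) + P(e) + P(g) = 0 whenever all these norms are even but not divisible
   by 4. *)
Require Import Defs.
From HB Require Import structures.
From mathcomp Require Import all_boot all_order all_algebra all_field.
From mathcomp Require Import ring zify.

Set Implicit Arguments.
Unset Strict Implicit.
Unset Printing Implicit Defensive.

Import Order.TTheory GRing.Theory Num.Theory.
Local Open Scope ring_scope.

(** * Circulant determinants *)

(** Row [k] of the transposed Vandermonde matrix [V] lists the powers of [w ^+ k]. It is a left
    eigenvector of the circulant, with the value of the polynomial at [w ^+ k] as eigenvalue. The
    powers of [w] are distinct, so [\det V] can be cancelled. *)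
Lemma det_circulant (F : fieldType) (n : nat) (w : F) (a : 'I_n.+1 -> F) :
  n.+1.-primitive_root w ->
  \det (\matrix_(i < n.+1, j < n.+1) a (i - j)) =
    \prod_(k < n.+1) \sum_(m < n.+1) a m * (w ^+ k) ^+ m.
Proof.
move=> w_prim; set A := \matrix_(i, j) _.
pose V := (Vandermonde n.+1 (\row_(k < n.+1) w ^+ k))^T.
have VA : V *m A =
    diag_mx (\row_(k < n.+1) \sum_(m < n.+1) a m * (w ^+ k) ^+ m) *m V.
  apply/matrixP=> k j; rewrite mul_diag_mx !mxE mulr_suml.
  rewrite [LHS](reindex_inj (addIr j)) /=; apply: eq_bigr => m _.
  have wk1 : (w ^+ k) ^+ n.+1 = 1.
    by rewrite exprAC (prim_expr_order w_prim) expr1n.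
  by rewrite !mxE addrK /= expr_mod // exprD mulrC mulrA.
have /mulIf : \det V != 0.
  rewrite det_tr det_Vandermonde; apply/prodf_neq0 => i _; apply/prodf_neq0.
  move=> j lt_ij; rewrite !mxE subr_eq0 (eq_prim_root_expr w_prim).
  by rewrite !modn_small // gtn_eqF.
apply; rewrite mulrC -det_mulmx VA det_mulmx det_diag.
by congr (_ * _); apply: eq_bigr => k _; rewrite mxE.
Qed.

Definition eval_low (F : fieldType) (n : nat) (a : nat -> int) (x : F) : F :=
  \sum_(j < n) (a j)%:~R * x ^+ j.

(** For a polynomial with [2n] coefficients, [fold_add] gives the remainder modulo [x^n - 1] and
    [fold_sub] the one modulo [x^n + 1]. Only indices below [n] are meaningful. Coefficients are
    indexed by [nat] so that foldings compose freely. *)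
Definition fold_add (n : nat) (a : nat -> int) (j : nat) : int :=
  a j + a (n + j)%N.

Definition fold_sub (n : nat) (a : nat -> int) (j : nat) : int :=
  a j - a (n + j)%N.

Lemma eval_fold_add (F : fieldType) n a (x : F) :
  x ^+ n = 1 -> eval_low (n + n) a x = eval_low n (fold_add n a) x.
Proof.
move=> xn; rewrite /eval_low big_split_ord /= -big_split.
apply: eq_bigr => j _ /=.
by rewrite exprD xn mul1r rmorphD mulrDl.
Qed.

Lemma eval_fold_sub (F : fieldType) n a (x : F) :
  x ^+ n = -1 -> eval_low (n + n) a x = eval_low n (fold_sub n a) x.
Proof.
move=> xn; rewrite /eval_low big_split_ord /= -big_split.
apply: eq_bigr => j _ /=.
by rewrite exprD xn mulN1r mulrN rmorphB mulrBl.
Qed.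

(** [norm8_re] and [norm8_im] are the real and imaginary parts of [e(x) e(-x)] in Z[i], where [x] is
    a primitive 8th root of unity and [i = x^2]: a relative norm. *)
Definition norm8_re (e : nat -> int) : int :=
  e 0%N ^+ 2 - e 2%N ^+ 2 + 2 * e 1%N * e 3%N.

Definition norm8_im (e : nat -> int) : int :=
  2 * e 0%N * e 2%N - e 1%N ^+ 2 + e 3%N ^+ 2.

(** Coefficients in powers of [y = x^2] of [c(x) c(-x)], where [x^8 = -1]: the relative norm from
    the 16th to the 8th cyclotomic ring. The default 0 is never read, as [y^4 = -1] leaves four
    coefficients. *)
Definition norm16 (c : nat -> int) (j : nat) : int :=
  match j with
  | 0%N => c 0%N ^+ 2 - c 4%N ^+ 2 - 2 * c 2%N * c 6%N
      + 2 * c 1%N * c 7%N + 2 * c 3%N * c 5%N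
  | 1%N => 2 * c 0%N * c 2%N - 2 * c 4%N * c 6%N
      - c 1%N ^+ 2 + c 5%N ^+ 2 + 2 * c 3%N * c 7%N
  | 2%N => c 2%N ^+ 2 - c 6%N ^+ 2 + 2 * c 0%N * c 4%N
      - 2 * c 1%N * c 3%N + 2 * c 5%N * c 7%N
  | 3%N => 2 * c 0%N * c 6%N + 2 * c 2%N * c 4%N - 2 * c 1%N * c 5%N
      - c 3%N ^+ 2 + c 7%N ^+ 2
  | _ => 0
  end.

Lemma eval_norm8 (F : fieldType) (e : nat -> int) (x : F) : x ^+ 4 = -1 ->
  eval_low 4 e x * eval_low 4 e (- x) =
    (norm8_re e)%:~R + (norm8_im e)%:~R * x ^+ 2.
Proof.
move=> x4; rewrite /eval_low !(big_ord_recr, big_ord0) /= /norm8_re /norm8_im.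
apply/eqP; rewrite -subr_eq0; apply/eqP.
(* The second factor is the quotient by [x^4 + 1] of the difference of the two sides. *)
transitivity ((x ^+ 4 + 1) * ((e 2%N)%:~R ^+ 2 - 2 * (e 1%N)%:~R * (e 3%N)%:~R
  - (e 3%N)%:~R ^+ 2 * x ^+ 2)); last by rewrite x4 addNr mul0r.
ring.
Qed.

Lemma eval_norm16 (F : fieldType) (c : nat -> int) (x : F) : x ^+ 8 = -1 ->
  eval_low 8 c x * eval_low 8 c (- x) = eval_low 4 (norm16 c) (x ^+ 2).
Proof.
move=> x8; rewrite /eval_low !(big_ord_recr, big_ord0) /=.
apply/eqP; rewrite -subr_eq0; apply/eqP.
transitivity ((x ^+ 8 + 1) * (
  (c 4%N)%:~R ^+ 2 + 2 * (c 2%N)%:~R * (c 6%N)%:~R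
   - 2 * (c 1%N)%:~R * (c 7%N)%:~R - 2 * (c 3%N)%:~R * (c 5%N)%:~R
  + (2 * (c 4%N)%:~R * (c 6%N)%:~R - (c 5%N)%:~R ^+ 2
     - 2 * (c 3%N)%:~R * (c 7%N)%:~R) * x ^+ 2
  + ((c 6%N)%:~R ^+ 2 - 2 * (c 5%N)%:~R * (c 7%N)%:~R) * x ^+ 4
  - (c 7%N)%:~R ^+ 2 * x ^+ 6)); last by rewrite x8 addNr mul0r.
ring.
Qed.

Definition sumsq (x y : int) : int := x ^+ 2 + y ^+ 2.

Lemma norm_conj (F : fieldType) (u v : int) (x : F) : x ^+ 2 = -1 ->
  (u%:~R + v%:~R * x) * (u%:~R - v%:~R * x) = (sumsq u v)%:~R.
Proof.
move=> x2; transitivity ((u%:~R : F) ^+ 2 - v%:~R ^+ 2 * x ^+ 2); first by ring.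
by rewrite x2 /sumsq; ring.
Qed.

(** The sixteen values of the polynomial are grouped by the order of the root of unity: orders 1 and
    2, then 4, 8 and 16. Within a group, [x] is paired with [-x] first, which gives the relative
    norms above. *)
Lemma D16_factor_root (F : numFieldType) (w : F) (a : 'I_16 -> int) :
  16.-primitive_root w ->
  let b := fold_add 8 (fun m => a (inord m)) in
  let c := fold_sub 8 (fun m => a (inord m)) in
  let d := fold_add 4 b in
  let e := fold_sub 4 b in
  let z := norm16 c in
  D16 a = ((d 0%N + d 2%N) ^+ 2 - (d 1%N + d 3%N) ^+ 2) *
    sumsq (d 0%N - d 2%N) (d 1%N - d 3%N) *
    sumsq (norm8_re e) (norm8_im e) * sumsq (norm8_re z) (norm8_im z).
Proof.
move=> w_prim b c d e z; apply: (@intr_inj F).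
have detE : (D16 a)%:~R =
    \prod_(k < 16) eval_low 16 (fun m => a (inord m)) (w ^+ k).
  rewrite -det_map_mx; pose a' i : F := (a i)%:~R.
  transitivity (\det (\matrix_(i < 16, j < 16) a' (i - j))).
    by congr (\det _); apply/matrixP=> i j; rewrite !mxE.
  rewrite (det_circulant _ w_prim); apply: eq_bigr => k _.
  by apply: eq_bigr => m _; rewrite inord_val.
have w8 : w ^+ 8 = -1.
  have /eqP := prim_expr_order w_prim.
  rewrite -[16%N]/(8 * 2)%N exprM sqrf_eq1 => /orP[|/eqP //].
  by rewrite -(prim_order_dvd w_prim).
set f := eval_low 16 _ in detE.
have f16 x : x ^+ 8 = -1 -> f x = eval_low 8 c x by exact: eval_fold_sub.
have f8 x : x ^+ 8 = 1 -> f x = eval_low 8 b x by exact: eval_fold_add.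
have b4 x : x ^+ 4 = 1 -> eval_low 8 b x = eval_low 4 d x.
  exact: eval_fold_add.
have b8 x : x ^+ 4 = -1 -> eval_low 8 b x = eval_low 4 e x.
  exact: eval_fold_sub.
have N4 (x : F) : (- x) ^+ 4 = x ^+ 4 by ring.
have N8 (x : F) : (- x) ^+ 8 = x ^+ 8 by ring.
have w4 : (w ^+ 4) ^+ 2 = -1 by rewrite -exprM.
have real_part :
    f 1 * f (- 1) = ((d 0%N + d 2%N) ^+ 2 - (d 1%N + d 3%N) ^+ 2)%:~R.
  rewrite !f8 ?b4 ?N8 ?N4 ?expr1n // /eval_low !(big_ord_recr, big_ord0) /=.
  ring.
have norm4 : f (w ^+ 4) * f (- w ^+ 4) =
    (sumsq (d 0%N - d 2%N) (d 1%N - d 3%N))%:~R.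
  have x4 (x : F) : x ^+ 2 = -1 -> x ^+ 4 = 1.
    by move=> x2; rewrite -[4%N]/(2 * 2)%N exprM x2 sqrrN expr1n.
  have x8 (x : F) : x ^+ 4 = 1 -> x ^+ 8 = 1.
    by move=> x4'; rewrite -[8%N]/(4 * 2)%N exprM x4' expr1n.
  have val x : x ^+ 2 = -1 ->
      f x = (d 0%N - d 2%N)%:~R + (d 1%N - d 3%N)%:~R * x.
    move=> x2; have x41 := x4 x x2; have x81 := x8 x x41.
    rewrite f8 // b4 // /eval_low !(big_ord_recr, big_ord0) /=.
    rewrite [x ^+ 3]exprS x2; ring.
  by rewrite !val ?sqrrN // mulrN norm_conj.
have norm8 x y : x ^+ 4 = -1 -> y ^+ 2 = - x ^+ 2 ->
    f x * f (- x) * (f y * f (- y)) = (sumsq (norm8_re e) (norm8_im e))%:~R.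
  move=> x4 y2; have y4 : y ^+ 4 = -1.
    by rewrite -[4%N]/(2 * 2)%N exprM y2 sqrrN -exprM.
  have val v : v ^+ 4 = -1 ->
      f v * f (- v) = (norm8_re e)%:~R + (norm8_im e)%:~R * v ^+ 2.
    move=> v4; have v8 : v ^+ 8 = 1.
      by rewrite -[8%N]/(4 * 2)%N exprM v4 sqrrN expr1n.
    by rewrite !f8 ?b8 ?eval_norm8 ?N8 ?N4.
  by rewrite !val // y2 mulrN norm_conj // -exprM.
(* The four roots [x, -x, y, -y] are only half of those of order 16, so the result lies in Z[i]. The
   other half, obtained from [w ^+ 3] and [w ^+ 7], gives the complex conjugate because
   [(w^3)^4 = - w^4]. *)
have norm16' x y : x ^+ 8 = -1 -> y ^+ 2 = - x ^+ 2 ->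
    f x * f (- x) * (f y * f (- y)) =
      (norm8_re z)%:~R + (norm8_im z)%:~R * x ^+ 4.
  move=> x8 y2; have y8 : y ^+ 8 = -1.
    by rewrite -[8%N]/(2 * 4)%N exprM y2 N4 -exprM.
  have val v : v ^+ 8 = -1 -> f v * f (- v) = eval_low 4 z (v ^+ 2).
    by move=> v8; rewrite !f16 ?eval_norm16 ?N8.
  by rewrite !val // y2 eval_norm8 -exprM.
have wD k : w ^+ (8 + k) = - w ^+ k by rewrite exprD w8 mulN1r.
have w1_4 : ((w ^+ 1) ^+ 4) ^+ 2 = -1 by rewrite -!exprM.
have w3_8 : (w ^+ 3) ^+ 8 = -1 by rewrite exprAC w8 -signr_odd.
have w5_2 : (w ^+ 5) ^+ 2 = - (w ^+ 1) ^+ 2 by rewrite -!exprM -wD.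
have w6_2 : (w ^+ 6) ^+ 2 = - (w ^+ 2) ^+ 2 by rewrite -!exprM -wD.
have w7_2 : (w ^+ 7) ^+ 2 = - (w ^+ 3) ^+ 2 by rewrite -!exprM -wD.
have w3_4 : (w ^+ 3) ^+ 4 = - (w ^+ 1) ^+ 4 by rewrite -!exprM -wD.
rewrite detE !(big_ord_recr, big_ord0) /= !rmorphM /= -real_part -norm4.
rewrite -(norm8 (w ^+ 2) (w ^+ 6)) //; last by rewrite -exprM.
rewrite -(norm_conj _ _ w1_4).
rewrite -(norm16' (w ^+ 1) (w ^+ 5)) //.
have := norm16' _ _ w3_8 w7_2; rewrite w3_4 mulrN => <-.
have := (wD 0, wD 1, wD 2, wD 3, (wD 4, wD 5, wD 6, wD 7))%N.
rewrite /= !addSn !add0n => -[[[[-> ->] ->] ->] [[[-> ->] ->] ->]].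
rewrite expr0 mul1r; ring.
Qed.

Lemma D16_factor (a : 'I_16 -> int) :
  let b := fold_add 8 (fun m => a (inord m)) in
  let c := fold_sub 8 (fun m => a (inord m)) in
  let d := fold_add 4 b in
  let e := fold_sub 4 b in
  let z := norm16 c in
  D16 a = ((d 0%N + d 2%N) ^+ 2 - (d 1%N + d 3%N) ^+ 2) *
    sumsq (d 0%N - d 2%N) (d 1%N - d 3%N) *
    sumsq (norm8_re e) (norm8_im e) * sumsq (norm8_re z) (norm8_im z).
Proof.
by have [w] := C_prim_root_exists (isT : (0 < 16)%N); apply: D16_factor_root.
Qed.

(** * Congruences for the norms *)

Lemma int_bit (x : int) : exists (w : int) (b : bool), x = 2 * w + b%:Z.
Proof.
exists (x %/ 2)%Z, ((x %% 2)%Z == 1).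
by case: eqP => /=; lia.
Qed.

(** The precision modulo 16, and not only 8, is what later determines [d 0 * d 2 - d 1 * d 3] modulo
    4. *)
Lemma pm1_mod8_sqr (x : int) :
  pm1_mod8 x -> exists n : int, x ^+ 2 = 16 * n + 1.
Proof.
by case=> m [->|->]; [exists (4 * m ^+ 2 + m) | exists (4 * m ^+ 2 - m)]; ring.
Qed.

Definition oddz (x : int) : Prop := exists m : int, x = 2 * m + 1.

Lemma sqr_subz_even (x : int) : exists k : int, x ^+ 2 = x + 2 * k.
Proof.
have [w [b ->]] := int_bit x.
by exists (2 * w ^+ 2 + 2 * w * b%:Z - w); case: b => /=; ring.
Qed.

(** With [P = e0 e2 - e1 e3], one has [2 P = (e0 + e2)^2 - 2 e2^2 - norm8_re e]. The first square is
    1 modulo 8 and [2 e2^2] is 0 or 2, so [2 P] is 0 or 2 up to sign modulo 8. The parity hypotheses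
    make [P] even, which leaves only 0. *)
Lemma norm8_re_pm1 (e : nat -> int) :
  oddz (e 0%N + e 2%N) -> oddz (e 1%N + e 3%N) -> pm1_mod8 (norm8_re e) ->
  exists j : int, e 0%N * e 2%N - e 1%N * e 3%N = 4 * j.
Proof.
rewrite /norm8_re; move: (e 0%N) (e 1%N) (e 2%N) (e 3%N) => x0 x1 x2 x3.
case=> m02 e02 [m13 e13] [m re].
have {e02} x0E : x0 = 2 * m02 + 1 - x2 by rewrite -e02 addrK.
have {e13} x1E : x1 = 2 * m13 + 1 - x3 by rewrite -e13 addrK.
have [k0 sq0] := sqr_subz_even m02; have [k3 sq3] := sqr_subz_even x3.
have [w [b x2E]] := int_bit x2.
set R := _ + _ in re.
have [k2 sq2] := sqr_subz_even x2.
have [y yE] : exists y, x0 * x2 - x1 * x3 = 2 * y.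
  exists (m02 * x2 - k2 - m13 * x3 + k3).
  transitivity ((2 * m02 + 1) * x2 - x2 ^+ 2 - (2 * m13 + 1) * x3 + x3 ^+ 2).
    by rewrite x0E x1E; ring.
  by rewrite sq2 sq3; ring.
have : 2 * (x0 * x2 - x1 * x3) = 8 * (m02 + k0) + 1 - 2 * x2 ^+ 2 - R.
  transitivity ((2 * m02 + 1) ^+ 2 - 2 * x2 ^+ 2 - R).
    by rewrite /R x0E; ring.
  by rewrite sqrrD exprMn sq0; ring.
have -> : x2 ^+ 2 = 4 * (w ^+ 2 + w * b%:Z) + b%:Z.
  by rewrite x2E; case: (b) => /=; ring.
rewrite yE => y_re; exists (y %/ 2)%Z.
by case: b {x2E} y_re; case: re => -> /=; lia.
Qed.

(** Finite check over the 256 parity patterns, with each coefficient replaced by its residue 0 or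
    1. *)
Lemma norm16_parity_bits (r : nat -> bool) :
  let c i := (r i)%:Z in let z := norm16 c in
  odd (r 0%N + r 2%N + r 4%N + r 6%N) -> odd (r 1%N + r 3%N + r 5%N + r 7%N) ->
  (4 %| z 0%N * z 2%N - z 1%N * z 3%N
    - 2 * (c 0%N * c 6%N + c 2%N * c 4%N + c 1%N * c 7%N + c 3%N * c 5%N))%Z.
Proof.
rewrite /norm16 /=.
by case: (r 0%N); case: (r 1%N); case: (r 2%N); case: (r 3%N); case: (r 4%N);
   case: (r 5%N); case: (r 6%N); case: (r 7%N).
Qed.

(** Every entry of [norm16] is a signed sum of squares and doubled products, hence modulo 4 depends
    only on the parities of the coefficients. This reduces the claim to [norm16_parity_bits]. *)
Lemma norm16_parity (c : nat -> int) :
  oddz (c 0%N + c 2%N + c 4%N + c 6%N) ->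
  oddz (c 1%N + c 3%N + c 5%N + c 7%N) ->
  let z := norm16 c in exists j : int, z 0%N * z 2%N - z 1%N * z 3%N =
    4 * j + 2 * (c 0%N * c 6%N + c 2%N * c 4%N + c 1%N * c 7%N + c 3%N * c 5%N).
Proof.
move=> [m0 odd0] [m1 odd1] z.
pose r i := (c i %% 2)%Z == 1; pose c' i := (r i)%:Z; pose z' := norm16 c'.
have lift i : exists t, c i = c' i + 2 * t.
  by exists (c i %/ 2)%Z; rewrite /c' /r; case: eqP => /=; lia.
have lift_sqr i : exists t, c i ^+ 2 = c' i ^+ 2 + 4 * t.
  by have [t ->] := lift i; exists (c' i * t + t ^+ 2); ring.
have lift_mul i j : exists t, 2 * c i * c j = 2 * c' i * c' j + 4 * t.
  have [t ->] := lift i; have [u ->] := lift j.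
  by exists (c' i * u + c' j * t + 2 * t * u); ring.
have [t0 z0] : exists t, z 0%N = z' 0%N + 4 * t.
  have [t1 e1] := lift_sqr 0%N; have [t2 e2] := lift_sqr 4%N.
  have [t3 e3] := lift_mul 2%N 6%N; have [t4 e4] := lift_mul 1%N 7%N.
  have [t5 e5] := lift_mul 3%N 5%N.
  exists (t1 - t2 - t3 + t4 + t5).
  by rewrite /z /z' /norm16 e1 e2 e3 e4 e5; ring.
have [t1 z1] : exists t, z 1%N = z' 1%N + 4 * t.
  have [t1 e1] := lift_mul 0%N 2%N; have [t2 e2] := lift_mul 4%N 6%N.
  have [t3 e3] := lift_sqr 1%N; have [t4 e4] := lift_sqr 5%N.
  have [t5 e5] := lift_mul 3%N 7%N.
  exists (t1 - t2 - t3 + t4 + t5).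
  by rewrite /z /z' /norm16 e1 e2 e3 e4 e5; ring.
have [t2 z2] : exists t, z 2%N = z' 2%N + 4 * t.
  have [t2 e1] := lift_sqr 2%N; have [t3 e2] := lift_sqr 6%N.
  have [t4 e3] := lift_mul 0%N 4%N; have [t5 e4] := lift_mul 1%N 3%N.
  have [t6 e5] := lift_mul 5%N 7%N.
  exists (t2 - t3 + t4 - t5 + t6).
  by rewrite /z /z' /norm16 e1 e2 e3 e4 e5; ring.
have [t3 z3] : exists t, z 3%N = z' 3%N + 4 * t.
  have [t3 e1] := lift_mul 0%N 6%N; have [t4 e2] := lift_mul 2%N 4%N.
  have [t5 e3] := lift_mul 1%N 5%N; have [t6 e4] := lift_sqr 3%N.
  have [t7 e5] := lift_sqr 7%N.
  exists (t3 + t4 - t5 - t6 + t7).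
  by rewrite /z /z' /norm16 e1 e2 e3 e4 e5; ring.
have oddr k0 k1 k2 k3 m :
    c k0 + c k1 + c k2 + c k3 = 2 * m + 1 -> odd (r k0 + r k1 + r k2 + r k3).
  have [u0 ->] := lift k0; have [u1 ->] := lift k1.
  have [u2 ->] := lift k2; have [u3 ->] := lift k3.
  by rewrite /c'; case: (r k0); case: (r k1); case: (r k2); case: (r k3) => /=;
    lia.
have /dvdzP[q zq] :=
  norm16_parity_bits (oddr _ _ _ _ _ odd0) (oddr _ _ _ _ _ odd1).
have [s0 e0] := lift_mul 0%N 6%N; have [s1 e1] := lift_mul 2%N 4%N.
have [s2 e2] := lift_mul 1%N 7%N; have [s3 e3] := lift_mul 3%N 5%N.
(* The terms in [t0], ..., [t3] come from expanding the two products of lifted entries, and the [s]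
   terms from lifting the doubled products on the right. *)
exists (q + t0 * z' 2%N + t2 * z' 0%N + 4 * t0 * t2
  - t1 * z' 3%N - t3 * z' 1%N - 4 * t1 * t3 - s0 - s1 - s2 - s3).
transitivity (z' 0%N * z' 2%N - z' 1%N * z' 3%N + 4 * (t0 * z' 2%N + t2 * z' 0%N
  + 4 * t0 * t2 - t1 * z' 3%N - t3 * z' 1%N - 4 * t1 * t3)).
  by rewrite [z 0%N]z0 [z 1%N]z1 [z 2%N]z2 [z 3%N]z3; ring.
rewrite -/c' -/z' in zq; move/eqP: zq; rewrite subr_eq => /eqP ->.
rewrite !mulrDr !mulrA e0 e1 e2 e3; ring.
Qed.

(** * Sums of two squares *)

(** In the field with [l] elements, [u^(l+1) = u^2], and [l + 1] is a multiple of 4. So raising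
    [u^2] to the even power [(l+1)/2] fixes it. Applied to [X^2 = - Y^2], this gives [X^2 = Y^2],
    hence [2 X^2 = 0]. *)
Lemma prime3_dvdn_sqrD (l x y : nat) :
  prime l -> (l %% 4 = 3)%N -> (l %| x ^ 2 + y ^ 2)%N -> (l %| x)%N.
Proof.
move=> l_pr l3; have chl := pchar_Fp l_pr.
rewrite !(dvdn_pcharf chl) natrD !natrX => /eqP.
set X : 'F_l := x%:R; set Y : 'F_l := y%:R => /eqP; rewrite addr_eq0 => /eqP XY.
have sq (u : 'F_l) : u ^+ 2 ^+ (2 * (l %/ 4).+1) = u ^+ 2.
  rewrite -exprM; have -> : (2 * (2 * (l %/ 4).+1) = l.+1)%N by lia.
  by rewrite exprSr -[X in u ^+ X](card_Fp l_pr) expf_card expr2.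
have : X ^+ 2 = Y ^+ 2 by rewrite -sq XY exprM sqrrN -exprM sq.
rewrite -[Y ^+ 2]opprK -XY => /eqP.
rewrite -addr_eq0 -mulr2n -mulr_natl mulf_eq0.
case/orP; last by rewrite expf_eq0.
rewrite -(dvdn_pcharf chl) dvdn_prime2 // => /eqP l2; by rewrite l2 in l3.
Qed.

Lemma pm1_mod8M (x y : int) : pm1_mod8 x -> pm1_mod8 y -> pm1_mod8 (x * y).
Proof.
move=> [m [->|->]] [n [->|->]].
- by exists (8 * m * n + m + n); left; ring.
- by exists (8 * m * n - m + n); right; ring.
- by exists (8 * m * n + m - n); right; ring.
- by exists (8 * m * n - m - n); left; ring.
Qed.

Lemma pm1_mod8D (x k : int) : pm1_mod8 x -> pm1_mod8 (x + 8 * k).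
Proof. by case=> m [->|->]; exists (m + k); [left | right]; ring. Qed.

Lemma pm1_mod8_pm (x y : int) : pm1_mod8 x -> pm1_mod8 y ->
  exists t : int, y = x + 8 * t \/ y = - x + 8 * t.
Proof.
move=> [m [->|->]] [n [->|->]].
- by exists (n - m); left; ring.
- by exists (n + m); right; ring.
- by exists (n + m); right; ring.
- by exists (n - m); left; ring.
Qed.

(** The two conclusions concern the parts of [(a + b i)(x + y i)]. Modulo 8, [y] is [x] or [-x], so
    each part becomes [(a + b) x] or [(a - b) x] up to sign. *)
Lemma pm1_mod8_gaussM (a b x y : int) :
  pm1_mod8 (a + b) -> pm1_mod8 (a - b) -> pm1_mod8 x -> pm1_mod8 y ->
  pm1_mod8 (a * x - b * y) /\ pm1_mod8 (b * x + a * y).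
Proof.
move=> ab_p ab_m x_pm y_pm; have [t [->|->]] := pm1_mod8_pm x_pm y_pm; split.
- have -> : a * x - b * (x + 8 * t) = (a - b) * x + 8 * (- b * t) by ring.
  exact/pm1_mod8D/pm1_mod8M.
- have -> : b * x + a * (x + 8 * t) = (a + b) * x + 8 * (a * t) by ring.
  exact/pm1_mod8D/pm1_mod8M.
- have -> : a * x - b * (- x + 8 * t) = (a + b) * x + 8 * (- b * t) by ring.
  exact/pm1_mod8D/pm1_mod8M.
- have -> : b * x + a * (- x + 8 * t) = (a - b) * (- 1 * x) + 8 * (a * t).
    by ring.
  apply/pm1_mod8D/pm1_mod8M => //; apply: pm1_mod8M => //.
  by exists 0; right.
Qed.

Definition special (l : nat) : Prop := exists a b : int,
  [/\ l%:Z = a ^+ 2 + b ^+ 2, pm1_mod8 (a + b) & pm1_mod8 (a - b)].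

(** Stated prime by prime so that it passes to divisors, which the descent on sums of two squares
    requires, and so that it covers both products of the theorem. *)
Definition admissible (n : nat) : Prop := forall l : nat,
  prime l -> (l %| n)%N ->
  [\/ (l %% 8 = 7)%N, special l | (l %% 8 = 3)%N /\ ~~ (l ^ 2 %| n)%N].

Lemma admissible_dvdn (m n : nat) :
  (m %| n)%N -> admissible n -> admissible m.
Proof.
move=> mn adm l l_pr lm; case: (adm l l_pr (dvdn_trans lm mn)).
- by constructor 1.
- by constructor 2.
- case=> l3 sqN; constructor 3; split=> //.
  by apply: contra sqN => /dvdn_trans->.
Qed.

Lemma dvdz_prime_sqr (l : nat) (x : int) :
  prime l -> (l%:Z %| x ^+ 2)%Z -> (l%:Z %| x)%Z.
Proof. by move=> l_pr; rewrite !dvdzE abszX Euclid_dvdX // => /andP[]. Qed.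

Lemma dvdz_prime_mul (l : nat) (x y : int) :
  prime l -> (l%:Z %| x * y)%Z -> (l%:Z %| x)%Z \/ (l%:Z %| y)%Z.
Proof. by move=> l_pr; rewrite !dvdzE abszM Euclid_dvdM // => /orP. Qed.

Lemma prime3_dvdz_sumsq (l : nat) (x y : int) :
  prime l -> (l %% 4 = 3)%N -> (l%:Z %| sumsq x y)%Z -> (l%:Z %| x)%Z.
Proof.
move=> l_pr l3; rewrite !dvdzE => lxy.
apply: (@prime3_dvdn_sqrD _ _ `|y|%N l_pr l3).
suff <- : `|sumsq x y|%N = (`|x| ^ 2 + `|y| ^ 2)%N by [].
rewrite /sumsq -[x ^+ 2]ger0_norm ?sqr_ge0 // -[y ^+ 2]ger0_norm ?sqr_ge0 //.
by rewrite -!abszE -PoszD absz_nat !abszX.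
Qed.

(** Division of [u + v i] by [a + b i]: the quotient is [(u + v i)(a - b i) / l]. The hypothesis
    makes the real part of the numerator divisible by [l]. The norm of the numerator is divisible by
    [l^2], which forces the same for the imaginary part. *)
Lemma sumsq_special (l m : nat) (a b u v : int) :
    prime l -> l%:Z = a ^+ 2 + b ^+ 2 -> (l%:Z %| u * a + v * b)%Z ->
    sumsq u v = 2 * (l * m)%N%:Z ->
  exists x y : int,
    [/\ sumsq x y = 2 * m%:Z, u = a * x - b * y & v = b * x + a * y].
Proof.
move=> l_pr lE /dvdzP[x xE] uv.
have l_neq0 : l%:Z != 0 by rewrite eqz_nat -lt0n prime_gt0.
have norm_mul :
    (u * a + v * b) ^+ 2 + (v * a - u * b) ^+ 2 = l%:Z ^+ 2 * (2 * m%:Z).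
  transitivity (sumsq u v * (a ^+ 2 + b ^+ 2)); first by rewrite /sumsq; ring.
  by rewrite uv -lE PoszM; ring.
have /dvdzP[y yE] : (l%:Z %| v * a - u * b)%Z.
  apply: dvdz_prime_sqr l_pr _.
  have -> : (v * a - u * b) ^+ 2 = (l%:Z * (2 * m%:Z - x ^+ 2)) * l%:Z.
    by apply: (addrI ((u * a + v * b) ^+ 2)); rewrite norm_mul xE; ring.
  exact: dvdz_mull.
exists x, y; split.
- apply: (mulfI (expf_neq0 2 l_neq0)).
  by rewrite -norm_mul xE yE /sumsq; ring.
- apply: (mulfI l_neq0).
  transitivity (a * (u * a + v * b) - b * (v * a - u * b)).
    by rewrite lE; ring.
  by rewrite xE yE; ring.
- apply: (mulfI l_neq0).
  transitivity (b * (u * a + v * b) + a * (v * a - u * b)).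
    by rewrite lE; ring.
  by rewrite xE yE; ring.
Qed.

(** Such a prime is inert in Z[i], so it divides both [u] and [v]; then [l^2] divides [2 n], and [l]
    is odd. *)
Lemma sumsq_prime3 (l n : nat) (u v : int) :
    prime l -> (l %% 4 = 3)%N -> (l %| n)%N -> sumsq u v = 2 * n%:Z ->
  exists (m : nat) (x y : int),
    [/\ n = (m * l ^ 2)%N, sumsq x y = 2 * m%:Z, u = x * l%:Z & v = y * l%:Z].
Proof.
move=> l_pr l3 ln uv.
have luv : (l%:Z %| sumsq u v)%Z by rewrite uv dvdz_mull // dvdzE.
have /dvdzP[x xE] := prime3_dvdz_sumsq l_pr l3 luv.
have /dvdzP[y yE] : (l%:Z %| v)%Z.
  by apply: (prime3_dvdz_sumsq (y := u)) l_pr l3 _; rewrite /sumsq addrC.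
have l_neq0 : l%:Z != 0 by rewrite eqz_nat -lt0n prime_gt0.
have sqE : sumsq x y * l%:Z ^+ 2 = 2 * n%:Z.
  by rewrite -uv xE yE /sumsq; ring.
have sqZ : (l ^ 2)%N%:Z = l%:Z ^+ 2 by rewrite -mulnn PoszM expr2.
have /dvdnP[m nE] : (l ^ 2 %| n)%N.
  have cop : coprime (l ^ 2) 2.
    by rewrite coprime_pexpl // prime_coprime // dvdn_prime2 //; apply/eqP; lia.
  rewrite -(Gauss_dvdr _ cop).
  suff : ((l ^ 2)%N%:Z %| (2 * n)%N%:Z)%Z by rewrite dvdzE.
  by rewrite [(2 * n)%N%:Z]PoszM -sqE sqZ dvdz_mull.
exists m, x, y; split=> //; apply: (mulIf (expf_neq0 2 l_neq0)).
by rewrite sqE nE PoszM sqZ mulrA.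
Qed.

(** Strong induction on [n], removing its least prime factor [l]; the base case is
    [u^2 + v^2 = 2]. *)
Lemma admissible_sumsq (n : nat) : (0 < n)%N -> admissible n ->
  forall u v : int, sumsq u v = 2 * n%:Z -> pm1_mod8 u /\ pm1_mod8 v.
Proof.
elim/ltn_ind: n => n IH n_gt0 adm u v uv.
have [n_gt1 | n_le1] := ltnP 1 n; last first.
  have n1 : n = 1%N by lia.
  move: uv; rewrite n1 /sumsq => uv.
  have unit_pm x y : x ^+ 2 + y ^+ 2 = 2 * 1%:Z -> pm1_mod8 x.
    rewrite !expr2 => xy.
    have y_neq : y * y <> 2.
      move=> yy; have y_le1 : y <= 1 by nia.
      have y_geN1 : -1 <= y by nia.
      have : y = 1 \/ y = 0 \/ y = -1 by lia.
      by case=> [|[]] yE; rewrite yE in yy.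
    have [->|->] : x = 1 \/ x = - 1.
      have x_le1 : x <= 1 by nia.
      have x_geN1 : -1 <= x by nia.
      have [x0|x0] := eqVneq x 0; last by lia.
      by rewrite x0 mul0r add0r in xy.
    - by exists 0; left.
    - by exists 0; right.
  by split; [apply: unit_pm uv | apply: (unit_pm v u); rewrite addrC].
have l_pr := pdiv_prime n_gt1; have ln := pdiv_dvd n.
move: (pdiv n) l_pr ln => l l_pr ln; have l_gt1 := prime_gt1 l_pr.
(* Both residues are 3 modulo 4, so [l^2] divides [n]. This contradicts the squarefree condition
   when [l] is 3 modulo 8. When [l] is 7, the smaller solution is multiplied by [l], which is -1
   modulo 8. *)
have good3 : (l %% 8 = 7)%N \/ (l %% 8 = 3)%N /\ ~~ (l ^ 2 %| n)%N ->
    pm1_mod8 u /\ pm1_mod8 v.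
  move=> lE; have l3 : (l %% 4 = 3)%N by lia.
  have [m [x [y [nE xy uE vE]]]] := sumsq_prime3 l_pr l3 ln uv.
  case: lE => [l7|[_]]; last by rewrite nE dvdn_mull.
  have mn : (m %| n)%N by rewrite nE dvdn_mulr.
  have m_gt0 : (0 < m)%N by move: n_gt0; rewrite nE muln_gt0 => /andP[].
  have m_lt : (m < n)%N.
    by rewrite nE -[X in (X < _)%N]muln1 ltn_pmul2l // -(exp1n 2) ltn_exp2r.
  have [x_pm y_pm] := IH m m_lt m_gt0 (admissible_dvdn mn adm) x y xy.
  have l_pm : pm1_mod8 l%:Z by exists (l %/ 8).+1%:Z; right; lia.
  by rewrite uE vE; split; apply: pm1_mod8M.
have [l7|[a [b [lE ab_p ab_m]]]|l3] := adm l l_pr ln; last 1 first.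
- by apply: good3; right.
- by apply: good3; left.
have /dvdnP[m] := ln; rewrite mulnC => nE.
have m_gt0 : (0 < m)%N by move: n_gt0; rewrite nE muln_gt0 => /andP[].
have m_lt : (m < n)%N by rewrite nE -[X in (X < _)%N]mul1n ltn_pmul2r.
have mn : (m %| n)%N by rewrite nE dvdn_mull.
have {}IH := IH m m_lt m_gt0 (admissible_dvdn mn adm).
rewrite nE in uv.
(* Since [l] divides this product, it divides one factor, that is, [a + b i] or its conjugate
   divides [u + v i]. In the conjugate case [b] becomes [-b], and the conditions on [a + b] and
   [a - b] are exchanged. *)
have : (l%:Z %| (u * a + v * b) * (u * a + v * - b))%Z.
  have -> : (u * a + v * b) * (u * a + v * - b) =
      u ^+ 2 * (a ^+ 2 + b ^+ 2) - b ^+ 2 * sumsq u v by rewrite /sumsq; ring.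
  rewrite -lE uv PoszM; apply/dvdzP.
  by exists (u ^+ 2 - b ^+ 2 * (2 * m%:Z)); ring.
case/(dvdz_prime_mul l_pr) => l_uv.
  have [x [y [xy -> ->]]] := sumsq_special l_pr lE l_uv uv.
  by have [x_pm y_pm] := IH x y xy; apply: pm1_mod8_gaussM.
have lE' : l%:Z = a ^+ 2 + (- b) ^+ 2 by rewrite sqrrN.
have [x [y [xy -> ->]]] := sumsq_special l_pr lE' l_uv uv.
by have [x_pm y_pm] := IH x y xy; apply: pm1_mod8_gaussM; rewrite ?opprK.
Qed.

(** * The determinant 64 n *)

Definition congr2 (x y : int) : Prop := exists t : int, x = y + 2 * t.

(** Modulo 2, [e(x) e(-x)] is [e(x)^2], hence [e(x^2)] by Frobenius, and [x^2 = i]. The same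
    argument gives [norm16_congr2]. *)
Lemma norm8_congr2 (e : nat -> int) :
  congr2 (norm8_re e) (e 0%N + e 2%N) /\ congr2 (norm8_im e) (e 1%N + e 3%N).
Proof.
have [k0 sq0] := sqr_subz_even (e 0%N); have [k1 sq1] := sqr_subz_even (e 1%N).
have [k2 sq2] := sqr_subz_even (e 2%N); have [k3 sq3] := sqr_subz_even (e 3%N).
rewrite /norm8_re /norm8_im sq0 sq1 sq2 sq3; split.
  by exists (k0 - e 2%N - k2 + e 1%N * e 3%N); ring.
by exists (e 0%N * e 2%N - e 1%N - k1 + k3); ring.
Qed.

Lemma norm16_congr2 (c : nat -> int) :
  congr2 (norm16 c 0%N + norm16 c 2%N) (c 0%N + c 2%N + c 4%N + c 6%N) /\
  congr2 (norm16 c 1%N + norm16 c 3%N) (c 1%N + c 3%N + c 5%N + c 7%N).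
Proof.
have [k0 sq0] := sqr_subz_even (c 0%N); have [k1 sq1] := sqr_subz_even (c 1%N).
have [k2 sq2] := sqr_subz_even (c 2%N); have [k3 sq3] := sqr_subz_even (c 3%N).
have [k4 sq4] := sqr_subz_even (c 4%N); have [k5 sq5] := sqr_subz_even (c 5%N).
have [k6 sq6] := sqr_subz_even (c 6%N); have [k7 sq7] := sqr_subz_even (c 7%N).
rewrite /norm16 sq0 sq1 sq2 sq3 sq4 sq5 sq6 sq7; split.
  exists (k0 - c 4%N - k4 - c 2%N * c 6%N + c 1%N * c 7%N + c 3%N * c 5%N +
    k2 - c 6%N - k6 + c 0%N * c 4%N - c 1%N * c 3%N + c 5%N * c 7%N); ring.
exists (c 0%N * c 2%N - c 4%N * c 6%N - c 1%N - k1 + k5 + c 3%N * c 7%N +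
  c 0%N * c 6%N + c 2%N * c 4%N - c 1%N * c 5%N - c 3%N - k3 + k7); ring.
Qed.

Lemma congr2_trans (x y z : int) : congr2 x y -> congr2 y z -> congr2 x z.
Proof. by move=> [s ->] [t ->]; exists (s + t); ring. Qed.

Lemma congr2_odd (x y : int) : congr2 x y -> oddz y -> oddz x.
Proof. by move=> [s ->] [t ->]; exists (s + t); ring. Qed.

Lemma oddzM (x y : int) : oddz x -> oddz y -> oddz (x * y).
Proof. by move=> [s ->] [t ->]; exists (2 * s * t + s + t); ring. Qed.

Lemma sumsq_congr2_odd (x y s t : int) : oddz (s + t) ->
  congr2 x s -> congr2 y t -> oddz (sumsq x y).
Proof.
move=> [k st] [m ->] [n ->].
have {st} tE : t = 2 * k + 1 - s by rewrite -st addrAC subrr add0r.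
exists (2 * (m * (s + m) + n * (t + n)) + 2 * k ^+ 2 + 2 * k - (2 * k + 1) * s
  + s ^+ 2).
by rewrite /sumsq tE; ring.
Qed.

Lemma sumsq_congr2_even (x y s t : int) :
  congr2 x (2 * s) -> congr2 y (2 * t) -> exists k, sumsq x y = 4 * k.
Proof.
move=> [m ->] [n ->]; exists ((s + m) ^+ 2 + (t + n) ^+ 2).
by rewrite /sumsq; ring.
Qed.

Lemma sumsq_odd (x y : int) :
  oddz x -> oddz y -> exists k, sumsq x y = 2 * k.
Proof.
move=> [m ->] [n ->]; exists (2 * (m ^+ 2 + m + n ^+ 2 + n) + 1).
by rewrite /sumsq; ring.
Qed.

Lemma subr_sqr_odd (x y : int) :
  oddz x -> oddz y -> exists k, x ^+ 2 - y ^+ 2 = 8 * k.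
Proof.
move=> [m ->] [n ->].
have [k sq] := sqr_subz_even m; have [l sq'] := sqr_subz_even n.
exists (m + k - n - l).
transitivity (4 * (m ^+ 2 + m) - 4 * (n ^+ 2 + n)); first by ring.
by rewrite sq sq'; ring.
Qed.

(** The prime 2 has the wrong residue modulo 8, and it is not special: [a + b] has the parity of
    [a^2 + b^2], while [pm1_mod8] makes it odd. *)
Lemma admissible_odd (n : nat) : admissible n -> odd n.
Proof.
move=> adm; apply/negPn/negP; rewrite -dvdn2 => /(adm 2 isT)[//| |[]//].
move=> [a [b [ab [m ab_pm] _]]].
have [k sq] := sqr_subz_even a; have [l sq'] := sqr_subz_even b.
by rewrite sq sq' in ab; case: ab_pm; lia.
Qed.

Lemma sumsq_factor_pm1 (n : nat) (m k x y : int) : (0 < n)%N -> admissible n ->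
  n%:Z = m * k -> sumsq x y = 2 * k -> pm1_mod8 x /\ pm1_mod8 y.
Proof.
move=> n_gt0 adm nE xy.
have kn : (`|k| %| n)%N by rewrite -[n]absz_nat nE abszM dvdn_mull.
(* The cofactor is an integer of unknown sign, and [admissible_sumsq] speaks of naturals. *)
have k_ge0 : 0 <= k.
  by rewrite -(pmulr_rge0 k (isT : 0 < 2 :> int)) -xy addr_ge0 ?sqr_ge0.
apply: admissible_sumsq (dvdn_gt0 n_gt0 kn) (admissible_dvdn kn adm) _ _ _.
by rewrite xy gez0_abs.
Qed.

(** Signs vanish modulo 2, so each of these sums is congruent to the sum of all coefficients of even
    index, or of odd index. *)
Lemma fold_congr2 (a : nat -> int) :
  let b := fold_add 8 a in let c := fold_sub 8 a in
  let d := fold_add 4 b in let e := fold_sub 4 b in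
  [/\ congr2 (e 0%N + e 2%N) (d 0%N + d 2%N),
      congr2 (e 1%N + e 3%N) (d 1%N + d 3%N),
      congr2 (c 0%N + c 2%N + c 4%N + c 6%N) (d 0%N + d 2%N)
    & congr2 (c 1%N + c 3%N + c 5%N + c 7%N) (d 1%N + d 3%N)].
Proof.
rewrite /fold_add /fold_sub !addSn !add0n; split.
- by exists (- (a 4%N + a 12%N + a 6%N + a 14%N)); ring.
- by exists (- (a 5%N + a 13%N + a 7%N + a 15%N)); ring.
- by exists (- (a 8%N + a 10%N + a 12%N + a 14%N)); ring.
- by exists (- (a 9%N + a 11%N + a 13%N + a 15%N)); ring.
Qed.

Lemma fold_pm1_contra (a : nat -> int) (h : int) :
  let b := fold_add 8 a in let c := fold_sub 8 a in
  let d := fold_add 4 b in let e := fold_sub 4 b in let z := norm16 c in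
  oddz (d 0%N + d 2%N) -> oddz (d 1%N + d 3%N) ->
  (d 0%N + d 2%N) ^+ 2 - (d 1%N + d 3%N) ^+ 2 = 16 * h + 8 ->
  pm1_mod8 (d 0%N - d 2%N) -> pm1_mod8 (d 1%N - d 3%N) ->
  pm1_mod8 (norm8_re e) -> pm1_mod8 (norm8_re z) -> False.
Proof.
move=> b c d e z odd02 odd13 oE u_pm v_pm e_pm z_pm.
have bE i : b i = c i + 2 * a (8 + i)%N.
  by rewrite /b /c /fold_add /fold_sub; ring.
have [_ _ c0 c1] := fold_congr2 a.
have [z0 z1] := norm16_congr2 c.
have [e0 e1 _ _] := fold_congr2 a.
have [j1 eP] : exists j, e 0%N * e 2%N - e 1%N * e 3%N = 4 * j.
  exact: norm8_re_pm1 (congr2_odd e0 odd02) (congr2_odd e1 odd13) e_pm.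
have odd_c0 := congr2_odd c0 odd02; have odd_c1 := congr2_odd c1 odd13.
have [j2 zP] : exists j, z 0%N * z 2%N - z 1%N * z 3%N = 4 * j.
  exact: norm8_re_pm1 (congr2_odd z0 odd_c0) (congr2_odd z1 odd_c1) z_pm.
have [j3 cP] : exists j, z 0%N * z 2%N - z 1%N * z 3%N = 4 * j +
    2 * (c 0%N * c 6%N + c 2%N * c 4%N + c 1%N * c 7%N + c 3%N * c 5%N).
  exact: norm16_parity odd_c0 odd_c1.
have [p sq_u] := pm1_mod8_sqr u_pm; have [q sq_v] := pm1_mod8_sqr v_pm.
(* This gives [d 0 * d 2 - d 1 * d 3] congruent to 2 modulo 4. The rest of the proof shows that it
   is 0 modulo 4. *)
have dP : 4 * (d 0%N * d 2%N - d 1%N * d 3%N) = 16 * h + 8 - 16 * p + 16 * q.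
  transitivity (((d 0%N + d 2%N) ^+ 2 - (d 1%N + d 3%N) ^+ 2)
      - (d 0%N - d 2%N) ^+ 2 + (d 1%N - d 3%N) ^+ 2); first by ring.
  by rewrite oE sq_u sq_v; ring.
have dbP : d 0%N * d 2%N - d 1%N * d 3%N = 4 * j1 +
    2 * (b 0%N * b 6%N + b 2%N * b 4%N - b 1%N * b 7%N - b 3%N * b 5%N).
  by rewrite -eP /d /e /fold_add /fold_sub !addSn !add0n; ring.
(* Since [b] and [c] agree modulo 2, the signs and the choice of folding affect only a multiple of
   2. The right-hand form is the one occurring in [cP], and there it is even by [zP]. *)
have [t bcP] : exists t,
    b 0%N * b 6%N + b 2%N * b 4%N - b 1%N * b 7%N - b 3%N * b 5%N =
    c 0%N * c 6%N + c 2%N * c 4%N + c 1%N * c 7%N + c 3%N * c 5%N + 2 * t.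
  rewrite !bE; pose x i := a (8 + i)%N; rewrite -!/(x _).
  exists (c 0%N * x 6%N + c 6%N * x 0%N + 2 * x 0%N * x 6%N
    + c 2%N * x 4%N + c 4%N * x 2%N + 2 * x 2%N * x 4%N
    - c 1%N * x 7%N - c 7%N * x 1%N - 2 * x 1%N * x 7%N - c 1%N * c 7%N
    - c 3%N * x 5%N - c 5%N * x 3%N - 2 * x 3%N * x 5%N - c 3%N * c 5%N).
  by ring.
by move: dP cP; rewrite dbP bcP zP; lia.
Qed.

Lemma not_S16_64 (n : nat) : (0 < n)%N -> admissible n -> ~ S16 (64 * n%:Z).
Proof.
move=> n_gt0 adm [a0]; rewrite D16_factor; set a := fun m => a0 (inord m).
set b := fold_add 8 a; set c := fold_sub 8 a.
set d := fold_add 4 b; set e := fold_sub 4 b; set z := norm16 c.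
have [ec0 ec1 cc0 cc1] := fold_congr2 a.
have [er ei] := norm8_congr2 e; have [zr zi] := norm8_congr2 z.
have [z0 z1] := norm16_congr2 c.
have {ec0}er := congr2_trans er ec0; have {ec1}ei := congr2_trans ei ec1.
have {z0 cc0}zr := congr2_trans zr (congr2_trans z0 cc0).
have {z1 cc1}zi := congr2_trans zi (congr2_trans z1 cc1).
have ur : congr2 (d 0%N - d 2%N) (d 0%N + d 2%N) by exists (- d 2%N); ring.
have ui : congr2 (d 1%N - d 3%N) (d 1%N + d 3%N) by exists (- d 3%N); ring.
have n_odd : n%:Z = 2 * (n %/ 2)%N%:Z + 1 by have := admissible_odd adm; lia.
have contra := @fold_pm1_contra a.
rewrite -/b -/c -/d -/e -/z /= in contra er ei zr zi *.
move: (d 0%N + d 2%N) (d 1%N + d 3%N) (d 0%N - d 2%N) (d 1%N - d 3%N)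
  er ei zr zi ur ui contra => E O u v er ei zr zi ur ui contra nE.
(* Here [E + O] and [E - O] are the values of the polynomial at 1 and -1. If they are odd, all four
   factors are odd, so the determinant is odd. *)
have mixed : ~ oddz (E + O).
  move=> oddEO; have oddo : oddz (E ^+ 2 - O ^+ 2).
    have -> : E ^+ 2 - O ^+ 2 = (E + O - 2 * O) * (E + O) by ring.
    by apply: oddzM => //; apply: congr2_odd oddEO; exists (- O); ring.
  have oddA := sumsq_congr2_odd oddEO ur ui.
  have oddB := sumsq_congr2_odd oddEO er ei.
  have oddC := sumsq_congr2_odd oddEO zr zi.
  have := oddzM (oddzM (oddzM oddo oddA) oddB) oddC.
  by rewrite -nE; case=> m; lia.
have [w1 [[] EE]] := int_bit E; have [w2 [[] OE]] := int_bit O;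
  rewrite /= ?addr0 in EE OE.
- have oddE : oddz E by exists w1.
  have oddO : oddz O by exists w2.
  have [o oE] := subr_sqr_odd oddE oddO.
  have [ka nA] := sumsq_odd (congr2_odd ur oddE) (congr2_odd ui oddO).
  have [ke nB] := sumsq_odd (congr2_odd er oddE) (congr2_odd ei oddO).
  have [kz nC] := sumsq_odd (congr2_odd zr oddE) (congr2_odd zi oddO).
  (* With [E] and [O] both odd, the factors contribute [8 * 2 * 2 * 2 = 64], so the cofactors
     multiply to [n]. *)
  have {}nE : n%:Z = o * ka * ke * kz.
    apply: (mulfI (_ : (64 : int) != 0)) => //.
    by rewrite nE oE nA nB nC; ring.
  have [|u_pm v_pm] := @sumsq_factor_pm1 n (o * ke * kz) ka u v n_gt0 adm _ nA.
    by rewrite nE; ring.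
  have [|e_pm _] := @sumsq_factor_pm1 n (o * ka * kz) ke _ _ n_gt0 adm _ nB.
    by rewrite nE; ring.
  have [z_pm _] := @sumsq_factor_pm1 n (o * ka * ke) kz _ _ n_gt0 adm nE nC.
  (* As [n] is odd, so is [o], and [8 o] has the form [16 w + 8] that [fold_pm1_contra] requires. *)
  have [w [[] oW]] := int_bit o.
    apply: (contra w) => //; rewrite oE oW /=; ring.
  by move: nE n_odd; rewrite oW /= addr0 -!mulrA; lia.
- by apply: mixed; exists (w1 + w2); rewrite EE OE; ring.
- by apply: mixed; exists (w1 + w2); rewrite EE OE; ring.
- rewrite EE in er zr ur; rewrite OE in ei zi ui.
  have [ka nA] := sumsq_congr2_even ur ui.
  have [ke nB] := sumsq_congr2_even er ei.
  have [kz nC] := sumsq_congr2_even zr zi.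
  (* With [E] and [O] both even, each of the four factors is a multiple of 4. Their product is a
     multiple of 256, and [n] would be a multiple of 4. *)
  have : n%:Z = 4 * ((w1 ^+ 2 - w2 ^+ 2) * ka * ke * kz).
    apply: (mulfI (_ : (64 : int) != 0)) => //.
    by rewrite nE EE OE nA nB nC; ring.
  by rewrite n_odd; lia.
Qed.

(** * Admissibility of the products in the theorem *)

Lemma prime_dvd_prod (I : finType) (A : pred I) (l : nat) (F k : I -> nat) :
  prime l -> (forall i, prime (F i)) -> (l %| \prod_(i | A i) F i ^ k i)%N ->
  exists2 i, A i & l = F i.
Proof.
move=> l_pr F_pr; rewrite Euclid_dvd_prod // big_orE => /existsP[i /andP[Ai]].
rewrite Euclid_dvdX // => /andP[lF _].
by exists i => //; apply/eqP; rewrite -dvdn_prime2.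
Qed.

Theorem theorem4p1 (r s t : nat)
  (p : 'I_(r + s) -> nat) (q : 'I_t -> nat) (k : 'I_(r + s) -> nat)
  (hp1 : forall i : 'I_r,
     [/\ prime (p (lshift s i)),
         (p (lshift s i) = 1 %[mod 8])%N
       & exists a b : int,
           [/\ (p (lshift s i))%:Z = a ^+ 2 + b ^+ 2,
               pm1_mod8 (a + b) & pm1_mod8 (a - b)]])
  (hp7 : forall j : 'I_s,
     prime (p (rshift r j)) /\ (p (rshift r j) = 7 %[mod 8])%N)
  (hq : forall l : 'I_t, prime (q l) /\ (q l = 3 %[mod 8])%N)
  (hq_inj : injective q) :
  ~ S16 (64 * \prod_(i < r + s) (p i)%:Z ^+ k i) /\
  ~ S16 (64 * \prod_(i < r + s) (p i)%:Z ^+ k i * \prod_(l < t) (q l)%:Z).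
have p_good (i : 'I_(r + s)) :
    prime (p i) /\ ((p i %% 8 = 7)%N \/ (p i %% 8 = 1)%N /\ special (p i)).
  rewrite -[i]splitK; case: (split i) => j /=.
    by have [? ? ?] := hp1 j; split=> //; right.
  by have [? ?] := hp7 j; split=> //; left.
set P := (\prod_(i < r + s) p i ^ k i)%N; set Q := (\prod_(l < t) q l)%N.
have PZ : \prod_(i < r + s) (p i)%:Z ^+ k i = P%:Z.
  rewrite -natz /P natr_prod; apply: eq_bigr => i _.
  by rewrite natrX natz.
have QZ : \prod_(l < t) (q l)%:Z = Q%:Z.
  by rewrite -natz /Q natr_prod; apply: eq_bigr => i _; rewrite natz.
have PQ_gt0 : (0 < P * Q)%N.
  rewrite muln_gt0 !prodn_gt0 // => i; rewrite ?expn_gt0 prime_gt0 //.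
    by have [] := hq i.
  by have [] := p_good i.
(* Admissibility of the larger product suffices, since [P] divides [P * Q]. *)
have adm : admissible (P * Q).
  move=> l l_pr; rewrite Euclid_dvdM // => /orP[lP|].
    have [i _ ->] := prime_dvd_prod l_pr (fun i => (p_good i).1) lP.
    by have [_ [p7|[_ p1]]] := p_good i; [constructor 1 | constructor 2].
  have q_pr i : prime (q i) by have [] := hq i.
  (* Exponents 1 put the product in the shape that [prime_dvd_prod] expects. *)
  have QE (A : pred 'I_t) : (\prod_(i | A i) q i = \prod_(i | A i) q i ^ 1)%N.
    by apply: eq_bigr => i _; rewrite expn1.
  rewrite /Q QE => /(prime_dvd_prod l_pr q_pr)[i _ lE]; have [_ l3] := hq i.
  constructor 3; split; first by rewrite lE.
  (* No prime in [P] has residue 3 modulo 8 (a special one is 1 here), so a square of [l] dividing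
     [P * Q] would divide [Q]. Removing [q i] would then give another index with the same prime,
     against [hq_inj]. *)
  have l_not_P : ~~ (l %| P)%N.
    apply/negP => /(prime_dvd_prod l_pr (fun i => (p_good i).1))[j _].
    by have [_ [pj|[pj _]]] := p_good j; rewrite lE => qp; move: l3;
      rewrite qp pj.
  rewrite Gauss_dvdr; last by rewrite coprime_pexpl ?prime_coprime.
  rewrite -QE (bigD1 i) //= -lE -mulnn dvdn_pmul2l ?prime_gt0 // QE.
  apply/negP => /(prime_dvd_prod l_pr q_pr)[j /eqP ji lj].
  by apply/ji/hq_inj; rewrite -lE -lj.
rewrite PZ QZ -mulrA -PoszM; split; last exact: not_S16_64.
apply: not_S16_64; first by move: PQ_gt0; rewrite muln_gt0 => /andP[].
exact: admissible_dvdn (dvdn_mulr _ _) adm.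
Qed.
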